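(* Suppose $e_-(t)=e_+(t+\phi)$ for all $t\ge0$, for some $\phi\in\,]0,1[$. Then the stochastic resonance point of the diffusions $(X^\varepsilon)$ with time periodic drift $b$ and the stochastic resonance point of the Markov chains $(Y^\varepsilon)$ with exponential transition rate functions $e_\pm$ coincide (one exists if and only if the other does, and then they are equal).
   Context: Setting. $b:[0,\infty)\times\mathbb R^d\to\mathbb R^d$ is one-periodic in its first (time) variable and satisfies: for all $R>0$, $x\in\mathbb R^d$ there are constants $K_R(x),\kappa_R(x)$ with $\|b(t,y_1)-b(t,y_2)\|\le K_R(x)\|y_1-y_2\|$ and $\|b(t,y)-b(s,y)\|\le\kappa_R(x)|t-s|$ for all $y,y_1,y_2\in B_R(x)$, $s,t\ge0$; and there are constants $\bar\eta,R_0>0$ with $\langle x,b(t,x)\rangle<-\bar\eta\|x\|$ for all $t\ge0$, $\|x\|\ge R_0$. For every $s\ge0$ the frozen equation $\dot\varphi_s(t)=b(s,\varphi_s(t))$ in $\mathbb R^d$ has two stable equilibria $x_-,x_+$ which do not depend on $s$; their domains of attraction $A_\pm$ do not depend on $s$, and $\overline{A_-\cup A_+}=\mathbb R^d$, $\partial A_-=\partial A_+=:\chi$. For $\varepsilon,\mu>0$, $T^\varepsilon=\exp(\mu/\varepsilon)$, and $X^\varepsilon$ solves $dX^\varepsilon_t=b(t/T^\varepsilon,X^\varepsilon_t)\,dt+\sqrt\varepsilon\,dW_t$ with $W$ a $d$-dimensional Brownian motion. Energies. $C_{0t}=C([0,t],\mathbb R^d)$; $I^s_{0t}(\varphi)=\frac12\int_0^t\|\dot\varphi_u-b(s,\varphi_u)\|^2du$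 if $\varphi$ is absolutely continuous, $+\infty$ otherwise; $V^s(x,y)=\inf_{t>0}\inf\{I^s_{0t}(\varphi):\varphi\in C_{0t},\varphi_0=x,\varphi_t=y\}$; $e_\pm(s)=\inf_{y\in\chi}V^s(x_\pm,y)<\infty$ (the energy needed to leave $A_\pm$), continuous one-periodic functions. Each of $e_-,e_+$ is assumed strictly monotone between its (discrete) extremes, with every local extremum global. Set $a^\pm_\mu=\inf\{t\ge0:e_\pm(t)\le\mu\}$ and $$I_R=\Big]\max_{i=\pm}\inf_{t\ge0}e_i(t),\ \inf_{t\ge0}\max_{i=\pm}e_i(t)\Big[.$$ It is assumed that $e_i(0)>\inf_{t\ge0}\max_{j=\pm}e_j(t)$ for $i=\pm$. Resonance point of $(X^\varepsilon)$. If (for small $h>0$) the function $I_R\ni\mu\mapsto\max_{i=\pm}\{\mu-e_i(a^i_\mu-h)\}$ possesses a global minimum at $\mu_R(h)$, and $\mu_R=\lim_{h\to0}\mu_R(h)$ exists in $I_R$, then $\mu_R$ is called the stochastic resonance point of $(X^\varepsilon)$. Reduced Markov chain. $Y^\varepsilon$ is the time-inhomogeneous continuous-time Markov chain on $\{-,+\}$ which at time $t$ jumps from state $i$ to state $-i$ with rate $\exp\{-e_i(t/T^\varepsilon)/\varepsilon\}$, $i=\pm$. $\mathbb P_i$ denotes its law when started at $i$ at time $0$, and $\sigma_{-i}$ the first time it reaches $-i$. For $h>0$ put $$\mathcal N(\varepsilon,\mu)=\min_{i=\pm}\mathbb P_i\big(\sigma_{-i}\in[(a^i_\mu-h)T^\varepsilon,(a^i_\mu+h)T^\varepsilon]\big),\qquad\varepsilon>0,\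 \mu\in I_R.$$ Resonance point of $(Y^\varepsilon)$. Defined in the same way: if (for small $h>0$) the function $I_R\ni\mu\mapsto\lim_{\varepsilon\to0}\varepsilon\log(1-\mathcal N(\varepsilon,\mu))$ possesses a global minimum at $\mu_R(h)$, and $\lim_{h\to0}\mu_R(h)$ exists in $I_R$, this limit is the stochastic resonance point of $(Y^\varepsilon)$. *)

(* Defs.v *)
From HB Require Import structures.
From mathcomp Require Import all_boot all_order all_algebra.
From mathcomp Require Import all_classical all_reals all_analysis.

Set Implicit Arguments.
Unset Strict Implicit.
Unset Printing Implicit Defensive.

Import Order.TTheory GRing.Theory Num.Theory.
Import numFieldNormedType.Exports.

Local Open Scope classical_set_scope.
Local Open Scope ring_scope.

(* The index set {-,+} is [bool]: - is [false], + is [true], -i is [~~ i].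
   Functions of time are total on [R]; only their values on [0, +oo[ matter. *)

Section Euclidean.
Context {R : realType} {d : nat}.
Implicit Types x y : 'rV[R]_d.

Definition dot x y : R := \sum_(j < d) x 0 j * y 0 j.

(* The library norm on ['rV_d] is the sup norm, hence this definition; the two
   norms induce the same topology. *)
Definition enorm x : R := Num.sqrt (dot x x).

Definition boundary (A : set 'rV[R]_d) : set 'rV[R]_d := closure A `\` A°.

End Euclidean.

Section Drift.
Context {R : realType} {d : nat}.
Local Notation V := 'rV[R]_d.
Implicit Types (b : R -> V -> V) (s t : R) (phi : R -> V).

Record periodic_dissipative_drift b : Prop := {
  drift_periodic : forall t x, 0 <= t -> b (t + 1) x = b t x ;
  drift_lipschitz_space : forall r x, 0 < r -> exists K : R,
    forall t y1 y2, 0 <= t -> enorm (y1 - x) < r -> enorm (y2 - x) < r ->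
      enorm (b t y1 - b t y2) <= K * enorm (y1 - y2) ;
  drift_lipschitz_time : forall r x, 0 < r -> exists kappa : R,
    forall s t y, 0 <= s -> 0 <= t -> enorm (y - x) < r ->
      enorm (b t y - b s y) <= kappa * `|t - s| ;
  drift_dissipative : exists eta R0 : R, [/\ 0 < eta, 0 < R0 &
    forall t x, 0 <= t -> R0 <= enorm x -> dot x (b t x) < - eta * enorm x]
}.

Definition frozen_solution b s phi : Prop :=
  {within `[0, +oo[, continuous phi} /\
  forall t, 0 < t -> is_derive t 1 phi (b s (phi t)).

(* Stability in the sense of Lyapunov. *)
Definition stable_equilibrium b s (x : V) : Prop :=
  b s x = 0 /\
  forall eps : R, 0 < eps -> exists2 delta : R, 0 < delta &
    forall phi, frozen_solution b s phi -> enorm (phi 0 - x) < delta ->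
      forall t, 0 <= t -> enorm (phi t - x) < eps.

Definition attraction_domain b s (x : V) : set V :=
  [set y | exists phi, [/\ frozen_solution b s phi, phi 0 = y &
                           phi t @[t --> +oo] --> x]].

Record bistable b (x : bool -> V) (A : bool -> set V) (chi : set V) : Prop := {
  equilibria_distinct : x false != x true ;
  equilibria_stable : forall i s, 0 <= s -> stable_equilibrium b s (x i) ;
  attraction_domainE : forall i s, 0 <= s -> attraction_domain b s (x i) = A i ;
  attraction_domain_dense : closure (A false `|` A true) = setT ;
  attraction_domain_boundary : forall i, boundary (A i) = chi
}.

Definition absolutely_continuous_path t phi : Prop :=
  forall eps : R, 0 < eps -> exists2 delta : R, 0 < delta &
    forall n (u v : 'I_n -> R),
      (forall k, [/\ 0 <= u k, u k <= v k & v k <= t]) ->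
      trivIset [set: 'I_n] (fun k => `]u k, v k[%classic) ->
      \sum_(k < n) (v k - u k) < delta ->
      \sum_(k < n) enorm (phi (v k) - phi (u k)) < eps.

Definition velocity phi (u : R) : V := \row_j derive1 (fun r : R => phi r 0 j) u.

Definition action b s t phi : \bar R :=
  if `[< absolutely_continuous_path t phi >] then
    (2^-1%:E *
      \int[lebesgue_measure]_(u in `[0%R, t])
        (enorm (velocity phi u - b s (phi u)) ^+ 2)%:E)%E
  else +oo%E.

Definition quasi_potential b s (x y : V) : \bar R :=
  ereal_inf [set ereal_inf [set action b s t phi | phi in
      [set phi : R -> V | [/\ {within `[0, t], continuous phi}, phi 0 = x & phi t = y]]]
    | t in [set t : R | 0 < t]].

Definition exit_energy b (x : bool -> V) (chi : set V) (i : bool) s : \bar R :=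
  ereal_inf [set quasi_potential b s (x i) y | y in chi].

Definition energy b (x : bool -> V) (chi : set V) (i : bool) s : R :=
  fine (exit_energy b x chi i s).

End Drift.

Section Energies.
Context {R : realType}.
Implicit Types (f : R -> R) (e : bool -> R -> R) (s t c : R).

Definition local_max f t : Prop := \forall s \near t, f s <= f t.
Definition local_min f t : Prop := \forall s \near t, f t <= f s.

(* Extremes are those of the periodic function: they are sought at times [t > 0]
   only, because [0] is equivalent to [1] by periodicity whereas the endpoint of
   [0, +oo[ would be a spurious one-sided extremum. *)
Definition extreme f t : Prop := 0 < t /\ (local_max f t \/ local_min f t).

Record monotone_between_extremes f : Prop := {
  extremes_discrete : forall c, finite_set [set t | extreme f t /\ t <= c] ;
  local_max_global : forall t, 0 < t -> local_max f t ->
    forall s, 0 <= s -> f s <= f t ;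
  local_min_global : forall t, 0 < t -> local_min f t ->
    forall s, 0 <= s -> f t <= f s ;
  strictly_monotone : forall s t, 0 <= s -> s < t ->
    (forall u, s < u < t -> ~ extreme f u) ->
    {in `[s, t] &, {homo f : u v / u < v}} \/
    {in `[s, t] &, {homo f : u v /~ u < v}}
}.

Definition time_inf f : R := inf [set f t | t in [set t | 0 <= t]].

Definition inf_max e : R := time_inf (fun t => Num.max (e false t) (e true t)).

Definition resonance_interval e : set R :=
  [set mu | Num.max (time_inf (e false)) (time_inf (e true)) < mu < inf_max e].

Definition entrance_time e (i : bool) (mu : R) : R :=
  inf [set t | 0 <= t /\ e i t <= mu].

(* [J h mu] is the functional minimised in [mu] over [I]; [m h] is mu_R(h). *)
Definition resonance_point (I : set R) (J : R -> R -> \bar R) (mu : R) : Prop :=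
  I mu /\ exists m : R -> R,
    (\forall h \near 0^'+,
       I (m h) /\ forall nu, I nu -> (J h (m h) <= J h nu)%E) /\
    m h @[h --> 0^'+] --> mu.

Definition time_scale (eps mu : R) : R := expR (mu / eps).

End Energies.

Section Diffusion.
Context {R : realType} {d : nat} {dT : measure_display} {T : measurableType dT}.
Local Notation V := 'rV[R]_d.
Implicit Types (P : probability T R) (W X : R -> T -> V) (t : R).

(* The product over [k] and [j] expresses at once that increments over disjoint
   intervals and their coordinates are independent and centred normal with
   variance [t k.+1 - t k]; [normal_prob] takes the standard deviation. *)
Record brownian_motion P W : Prop := {
  bm_measurable : forall t j, 0 <= t -> measurable_fun setT (fun w => W t w 0 j) ;
  bm_start : {ae P, forall w, W 0 w = 0} ;
  bm_continuous :
    {ae P, forall w, {within `[0, +oo[, continuous (fun t => W t w)}} ;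
  bm_increments : forall n (t : nat -> R) (B : nat -> 'I_d -> set R),
    0 <= t 0%N -> (forall k : nat, (k < n)%N -> t k < t k.+1) ->
    (forall k j, measurable (B k j)) ->
    P [set w | forall k j, (k < n)%N -> B k j (W (t k.+1) w 0 j - W (t k) w 0 j)]
    = (\prod_(k < n) \prod_(j < d)
        normal_prob 0 (Num.sqrt (t k.+1 - t k)) (B k j))%E
}.

(* The noise is additive, so the equation is a pathwise integral equation. *)
Record diffusion P W (b : R -> V -> V) (eps mu : R) (x0 : V) X : Prop := {
  diffusion_measurable :
    forall t j, 0 <= t -> measurable_fun setT (fun w => X t w 0 j) ;
  diffusion_equation : {ae P, forall w,
    {within `[0, +oo[, continuous (fun t => X t w)} /\
    forall t j, 0 <= t ->
      X t w 0 j = x0 0 j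
        + \int[lebesgue_measure]_(u in `[0, t])
            (b (u / time_scale eps mu) (X u w) 0 j)
        + Num.sqrt eps * W t w 0 j}
}.

End Diffusion.

Definition diffusion_resonance_point {R : realType} {d : nat}
    (b : R -> 'rV[R]_d -> 'rV[R]_d) (x : bool -> 'rV[R]_d) (chi : set 'rV[R]_d)
    (mu : R) : Prop :=
  let e := energy b x chi in
  let J h nu i := nu - e i (entrance_time e i nu - h) in
  resonance_point (resonance_interval e)
    (fun h nu => (Num.max (J h nu false) (J h nu true))%:E) mu.

Section Chain.
Context {R : realType}.
Implicit Types (s t : R) (i j k : bool).

Definition jump_rate (e : bool -> R -> R) (eps mu : R) (i : bool) (t : R) : R :=
  expR (- e i (t / time_scale eps mu) / eps).

(* [p s t j k] is the probability of being in [k] at time [t] when in [j] at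
   time [s]; the third clause is the Kolmogorov forward equation for the
   generator with rate [q i t] from [i] to [~~ i] at time [t], and the three
   clauses determine [p] on [0 <= s <= t]. *)
Record transition_function (q : bool -> R -> R)
    (p : R -> R -> bool -> bool -> R) : Prop := {
  transition_start : forall s j k, 0 <= s -> p s s j k = (j == k)%:R ;
  transition_continuous : forall s j k, 0 <= s ->
    {within `[s, +oo[, continuous (fun t => p s t j k)} ;
  transition_forward : forall s t j k, 0 <= s -> s < t ->
    is_derive t 1 (fun u => p s u j k)
      (p s t j (~~ k) * q (~~ k) t - p s t j k * q k t)
}.

Context {dT : measure_display} {T : measurableType dT}.
Implicit Types (P : probability T R) (Y : R -> T -> bool).

Record markov_chain P Y (q : bool -> R -> R) (i : bool) : Prop := {
  chain_measurable : forall t, 0 <= t -> measurable_fun setT (Y t) ;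
  chain_right_continuous : forall w t, 0 <= t ->
    \forall u \near t^'+, Y u w = Y t w ;
  chain_left_limits : forall w t, 0 < t ->
    exists j, \forall u \near t^'-, Y u w = j ;
  chain_distribution : exists2 p, transition_function q p &
    forall (n : nat) (t : nat -> R) (y : nat -> bool),
      t 0%N = 0 -> (forall k : nat, (k < n)%N -> t k < t k.+1) ->
      P [set w | forall k : nat, (k <= n)%N -> Y (t k) w = y k]
      = ((y 0%N == i)%:R * \prod_(k < n) p (t k) (t k.+1) (y k) (y k.+1))%:E
}.

Definition hitting_time Y (j : bool) (w : T) : \bar R :=
  ereal_inf [set t%:E | t in [set t | 0 <= t /\ Y t w = j]].

Definition chain_window_prob (e : bool -> R -> R)
    (P : R -> R -> bool -> probability T R) (Y : R -> R -> R -> T -> bool)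
    (h eps mu : R) : \bar R :=
  let prob i := P eps mu i
    [set w | (((entrance_time e i mu - h) * time_scale eps mu)%:E
                <= hitting_time (Y eps mu) (~~ i) w
                <= ((entrance_time e i mu + h) * time_scale eps mu)%:E)%E] in
  Order.min (prob false) (prob true).

(* [lne] is the extended logarithm, with [lne 0 = -oo]. *)
Definition chain_resonance_point (e : bool -> R -> R)
    (P : R -> R -> bool -> probability T R) (Y : R -> R -> R -> T -> bool)
    (mu : R) : Prop :=
  exists J : R -> R -> \bar R,
    (\forall h \near 0^'+, forall nu, resonance_interval e nu ->
      (eps%:E * lne (1 - chain_window_prob e P Y h eps nu))%E
        @[eps --> 0^'+] --> J h nu) /\
    resonance_point (resonance_interval e) J mu.

End Chain.

(* Main.v *)
(* For [nu] in [I_R] and small [h], uniformly in [nu], the probability of a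
   first jump outside the window is logarithmically equivalent to
   [exp (max_i (nu - e_i (a_i - h)) / eps)].
   The hazard accumulated by time [c T] is [\int_0^c exp ((nu - e_i u) / eps) du].
   Just after [a_i] the energy drops below [nu], so a jump later than
   [(a_i + h) T] has doubly exponentially small probability; a jump before
   [(a_i - h) T] has logarithmic rate [nu - min_[0, a_i - h] e_i].  As local
   minima are global and [e_i 0] lies above [I_R], that minimum is attained at
   [a_i - h].  The functional minimised for the chains is thus, for small [h],
   the one minimised for the diffusions. *)
Require Import Defs.
From mathcomp Require Import all_boot all_order all_algebra.
From mathcomp Require Import all_classical all_reals all_analysis.
From mathcomp Require Import ring lra.

Import Order.TTheory GRing.Theory Num.Theory.
Import numFieldNormedType.Exports.

Local Open Scope classical_set_scope.
Local Open Scope ring_scope.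

(** * First passage and sign preservation for real functions *)

Section RealFunctions.
Context {R : realType}.
Implicit Types (f g df : R -> R) (a c s t : R).

Lemma within_continuous_dist (A : set R) f t (eps : R) :
  {within A, continuous f} -> A t -> 0 < eps ->
  exists2 delta, 0 < delta &
    forall u, A u -> `|t - u| < delta -> `|f t - f u| < eps.
Proof.
move=> /subspace_continuousP /(_ t) cf At eps0.
have /cvgr_dist_lt/(_ _ eps0) := cf At.
rewrite near_withinE => -[delta /= delta0 H].
by exists delta => // u Au tu; exact: H.
Qed.

(** Continuity at [a] excludes [f a > c], because points with value at most [c] lie arbitrarily
    close to [a], and [f a < c], because the values before [a] exceed [c]. *)
Lemma first_passage f c T : 0 <= T ->
  {within `[0, T], continuous f} -> c < f 0 -> f T <= c ->
  let a := inf [set t | 0 <= t /\ f t <= c] in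
  [/\ 0 < a, a <= T, f a = c & forall t, 0 <= t -> t < a -> c < f t].
Proof.
move=> T0 cf f0 fT a.
set S := [set t | 0 <= t /\ f t <= c] in a *.
have hS : has_inf S by split; [exists T | exists 0 => t -[]].
have aT : a <= T by apply: ge_inf; [exact: hS.2 | split].
have a0 : 0 <= a by apply: lb_le_inf; [exists T | move=> t -[]].
have before t : 0 <= t -> t < a -> c < f t.
  move=> t0 ta; rewrite ltNge; apply/negP => ft.
  by move: ta; apply/negP; rewrite -leNgt; apply: ge_inf; [exact: hS.2|split].
have Ia : (`[0, T]%classic : set R) a by rewrite /= in_itv/= a0 aT.
have fa : f a <= c.
  rewrite leNgt; apply/negP => fac.
  have e0 : 0 < f a - c by rewrite subr_gt0.
  have [delta d0 H] := within_continuous_dist _ _ _ _ cf Ia e0.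
  have [u [u0 fu] ua] := inf_adherent d0 hS.
  have au : a <= u by apply: ge_inf; [exact: hS.2 | split].
  (* Continuity is assumed only up to [T]; if the nearby point lies beyond, then [T] itself is
     within [delta] of [a]. *)
  have [uT|uT] := leP u T.
    have := H u _ _; rewrite /= in_itv/= u0 uT => /(_ isT).
    rewrite distrC ger0_norm ?subr_ge0// => /(_ _).
    rewrite ltr_norml => /(_ ltac:(rewrite -/a in ua; lra)); lra.
  have := H T _ _; rewrite /= in_itv/= T0 lexx => /(_ isT).
  rewrite distrC ger0_norm ?subr_ge0// => /(_ _).
  rewrite ltr_norml => /(_ ltac:(rewrite -/a in ua; lra)); lra.
have a_gt0 : 0 < a.
  by rewrite lt_neqAle a0 andbT; apply/eqP => a_eq; move: fa; rewrite -a_eq leNgt f0.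
split => //; apply/eqP; rewrite eq_le fa leNgt/=; apply/negP => fac.
have e0 : 0 < c - f a by rewrite subr_gt0.
have [delta d0 H] := within_continuous_dist _ _ _ _ cf Ia e0.
(* A point of [0, a[ within [delta] of [a]. *)
pose u := Num.max 0 (a - delta / 2).
have u0 : 0 <= u by rewrite le_max lexx.
have ua : u < a by rewrite gt_max a_gt0 /=; lra.
have u1 : a - delta / 2 <= u by rewrite le_max lexx orbT.
have := H u _ _; rewrite /= in_itv/= u0 (ltW (lt_le_trans ua aT)) => /(_ isT).
rewrite ger0_norm ?subr_ge0 ?(ltW ua)// => /(_ ltac:(lra)).
rewrite ltr_norml; have := before u u0 ua; lra.
Qed.

Lemma le_increment f df (m : R) a c : a <= c -> {within `[a, c], continuous f} ->
  (forall t, a < t < c -> is_derive t 1 f (df t)) ->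
  (forall t, a < t < c -> m <= df t) -> m * (c - a) <= f c - f a.
Proof.
rewrite le_eqVlt => /predU1P[<-|ac] cf fdf mdf; first by rewrite !subrr mulr0.
have [t tac ->] := MVT ac (fun t (ht : t \in `]a, c[) =>
  fdf t (ltac:(by move: ht; rewrite in_itv))) cf.
by rewrite ler_pM2r ?subr_gt0 //; apply: mdf; move: tac; rewrite in_itv.
Qed.

Lemma ge_increment f df (m : R) a c : a <= c -> {within `[a, c], continuous f} ->
  (forall t, a < t < c -> is_derive t 1 f (df t)) ->
  (forall t, a < t < c -> df t <= m) -> f c - f a <= m * (c - a).
Proof.
rewrite le_eqVlt => /predU1P[<-|ac] cf fdf mdf; first by rewrite !subrr mulr0.
have [t tac ->] := MVT ac (fun t (ht : t \in `]a, c[) =>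
  fdf t (ltac:(by move: ht; rewrite in_itv))) cf.
by rewrite ler_pM2r ?subr_gt0 //; apply: mdf; move: tac; rewrite in_itv.
Qed.

(* If [f t < 0], the last zero of [f] before [t] is the first passage of the
   time-reversed function, and [f] is nondecreasing from there to [t]. *)
Lemma nonneg_if_increasing_below f df s :
  {within `[s, +oo[, continuous f} -> 0 <= f s ->
  (forall t, s < t -> is_derive t 1 f (df t)) ->
  (forall t, s < t -> f t < 0 -> 0 <= df t) ->
  forall t, s <= t -> 0 <= f t.
Proof.
move=> cf fs fdf dfpos t st; rewrite leNgt; apply/negP => ft.
pose g r := - f (t - r).
have cg : {within `[0, t - s], continuous g}.
  apply/subspace_continuousP => r; rewrite /= in_itv/= => /andP[r0 rts].
  apply/cvgrPdist_lt => eps eps0.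
  have [|delta d0 H] := within_continuous_dist _ _ (t - r) _ cf _ eps0.
    by rewrite /= in_itv/= andbT; lra.
  rewrite near_withinE; exists delta => //= u /= ru; rewrite in_itv/= => hu.
  rewrite /g opprK addrC distrC; apply: H; first by rewrite /= in_itv/= andbT; lra.
  by rewrite opprB addrC addrA subrK distrC.
have g0 : 0 < g 0 by rewrite /g subr0 oppr_gt0.
have gs : g (t - s) <= 0 by rewrite /g subKr oppr_le0.
have := first_passage g 0 (t - s) _ cg g0 gs; rewrite subr_ge0 => /(_ st).
set a := inf _ => -[a0 ats ga before].
have {}ga : f (t - a) = 0 by apply/eqP; rewrite -oppr_eq0 -/(g a) ga.
have cf' : {within `[t - a, t], continuous f}.
  apply: continuous_subspaceW cf => u /=; rewrite !in_itv/= andbT => /andP[]; lra.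
suff : 0 * (t - (t - a)) <= f t - f (t - a) by rewrite mul0r ga subr0 leNgt ft.
apply: (le_increment _ df) => //; first lra.
  by move=> u ?; apply: fdf; lra.
move=> u hu; apply: dfpos; first lra.
have := before (t - u); rewrite /g subKr oppr_gt0; apply; lra.
Qed.

End RealFunctions.

(** * Entrance times of an energy, and its minimum shortly before them *)

Section EntranceTime.
Context {R : realType} (f : R -> R).
Hypothesis f_cont : {within `[0, +oo[, continuous f}.
Hypothesis f_ge0 : forall t, 0 <= t -> 0 <= f t.
Hypothesis f_min : forall t, 0 < t -> local_min f t ->
  forall s, 0 <= s -> f t <= f s.

Lemma time_inf_ltP (c : R) : time_inf f < c -> exists2 t, 0 <= t & f t < c.
Proof.
(* Nonnegativity makes [inf] a true infimum and not a default value. *)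
move=> fc; have S_inf : has_inf [set f t | t in [set t | 0 <= t]].
  by split; [exists (f 0), 0 => /= | exists 0 => _ [t /= /f_ge0 ? <-]].
have [|_ [t /= t0 <-] ft] := inf_adherent (eps := c - time_inf f) _ S_inf.
  by rewrite subr_gt0.
by exists t => //; move: ft; rewrite -/(time_inf f) addrC subrK.
Qed.

Lemma passage_at_level (c : R) : time_inf f < c -> c < f 0 ->
  let a := inf [set t | 0 <= t /\ f t <= c] in
  [/\ 0 < a, f a = c & forall t, 0 <= t -> t < a -> c < f t].
Proof.
move=> /time_inf_ltP[T T0 fT] f0.
have [] // := first_passage f c T T0 _ f0 (ltW fT).
by apply: continuous_subspaceW f_cont => u /=; rewrite !in_itv/= andbT => /andP[].
Qed.

(* Before the passage at [nu] there is no local minimum in the interior, since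
   it would be global, hence below [nu].  So the minimum of [f] on [0, a - h] is
   attained at an endpoint, and not at [0] once [f] has gone below [f 0], which
   it has before reaching [D]. *)
Lemma passage_minimum (D : R) : D < f 0 ->
  exists2 h0, 0 < h0 & forall nu h : R, time_inf f < nu -> nu < D -> 0 < h < h0 ->
  let a := inf [set t | 0 <= t /\ f t <= nu] in
  [/\ 0 < a - h, nu < f (a - h), forall t, 0 <= t <= a - h -> f (a - h) <= f t
    & exists r, a < r < a + h /\ f r < nu].
Proof.
move=> Df0.
have [infD|infD] := ltP (time_inf f) D; last first.
  by exists 1 => // nu h fnu nuD; have := lt_trans fnu nuD; rewrite ltNge infD.
have ge_passage c t : 0 <= t -> f t <= c -> inf [set t | 0 <= t /\ f t <= c] <= t.
  by move=> t0 ft; apply: ge_inf; [exists 0 => u [] | split].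
(* Any level between [D] and [f 0] would do. Its passage [p] precedes the passage [aD] at [D], which
   is no later than the passage [a] at any [nu < D]; hence [h < aD - p] forces [p < a - h] uniformly
   in [nu]. *)
pose c := (D + f 0) / 2.
have [p0 fp _] := passage_at_level c ltac:(rewrite /c; lra) ltac:(rewrite /c; lra).
set p := inf _ in p0 fp.
have [aD0 faD _] := passage_at_level D infD Df0.
set aD := inf _ in aD0 faD.
have paD : p < aD.
  rewrite lt_neqAle; apply/andP; split.
    by apply/eqP => paD; move: fp; rewrite paD faD /c; lra.
  by apply: ge_passage; rewrite ?ltW// faD /c; lra.
exists (aD - p) => [|nu h fnu nuD /andP[h0 hlt] a]; first lra.
have [a0 fa before] := passage_at_level nu fnu (lt_trans nuD Df0).
rewrite -/a in a0 fa before.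
have aDa : aD <= a by apply: ge_passage; rewrite ?ltW// fa.
have pah : p < a - h by lra.
have [t1 t10 ft1] := time_inf_ltP nu fnu.
split; first lra.
- by apply: before; lra.
- have [||s] := EVT_min (f := f) (a := 0) (b := a - h); first lra.
    by apply: continuous_subspaceW f_cont => u /=; rewrite !in_itv/= andbT => /andP[].
  rewrite in_itv/= => /andP[s0 sah] smin.
  suff s_eq : s = a - h by move=> t ht; rewrite -[X in f X <= _]s_eq smin// in_itv.
  apply/eqP; rewrite eq_le sah leNgt/=; apply/negP => sah'.
  have s_gt0 : 0 < s.
    rewrite lt_neqAle s0 andbT; apply/eqP => s_eq.
    have := smin p; rewrite in_itv/= (ltW p0) (ltW pah) -s_eq fp => /(_ isT).
    by rewrite /c; lra.
  (* A minimiser inside ]0, a - h[ is a local minimum, hence global, although [f t1 < nu < f s]. *)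
  have : f s <= f t1.
    apply: f_min => //; near=> u; apply: smin; rewrite in_itv/=.
    apply/andP; split; near: u.
      exact: lt_le_nbhsr.
    exact: lt_le_nbhsl.
  by have := before s s0 ltac:(lra); lra.
(* If [f] stayed at or above [nu] on ]a, a + h[, then [a] would be a local minimum with value [nu],
   hence a global one, against [f t1 < nu]. *)
- apply: contrapT => nor.
  have : f a <= f t1.
    apply: f_min => //.
    have : \forall u \near a, 0 < u < a + h.
      by near=> u; apply/andP; split; near: u; [exact: lt_nbhsr|apply: lt_nbhsl; lra].
    apply: filterS => u /andP[u0 uah]; rewrite fa.
    have [ua|ua|->] := ltgtP u a; last by rewrite fa.
      by apply/ltW/before => //; exact: ltW.
    by rewrite leNgt; apply/negP => fu; apply: nor; exists u; rewrite ua uah.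
  by rewrite fa; lra.
Unshelve. all: by end_near.
Qed.

End EntranceTime.

(** * Logarithmic asymptotics as [eps] tends to 0 *)

Section ExponentialRate.
Context {R : realType}.
Implicit Types (G : R -> R) (A B C D : R).

(** Logarithmic equivalence of [G eps] with [expR (D / eps)]. Two-sided bounds whose prefactor may
    depend on [g] are what probability estimates yield directly, and they include the positivity
    needed before taking logarithms. *)
Definition exp_rate G D : Prop :=
  (forall g : R, 0 < g -> exists2 C, 0 < C &
    \forall eps \near 0^'+, G eps <= C * expR ((D + g) / eps)) /\
  (forall g : R, 0 < g -> exists2 C, 0 < C &
    \forall eps \near 0^'+, C * expR ((D - g) / eps) <= G eps).

Lemma exp_rate_gt0 G D : exp_rate G D -> \forall eps \near 0^'+, 0 < G eps.
Proof.
move=> [_ /(_ 1 ltr01)[C C0]]; apply: filterS => eps; apply: lt_le_trans.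
by rewrite mulr_gt0 ?expR_gt0.
Qed.

Lemma exp_rate_max G1 G2 D1 D2 : exp_rate G1 D1 -> exp_rate G2 D2 ->
  exp_rate (fun eps => Num.max (G1 eps) (G2 eps)) (Num.max D1 D2).
Proof.
move=> [U1 L1] [U2 L2]; split=> g g0.
  have [[C1 C10 H1] [C2 C20 H2]] := (U1 g g0, U2 g g0).
  exists (Num.max C1 C2); first by rewrite lt_max C10.
  have e0 : \forall eps \near (0 : R)^'+, 0 < eps by exact: nbhs_right_gt.
  near=> eps; have eps0 : 0 < eps by near: eps.
  have mono D C : C <= Num.max C1 C2 -> 0 < C -> D <= Num.max D1 D2 ->
      C * expR ((D + g) / eps) <= Num.max C1 C2 * expR ((Num.max D1 D2 + g) / eps).
    move=> hC C0 hD; rewrite ler_pM ?expR_ge0 ?(ltW C0)// ler_expR.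
    by rewrite ler_pM2r ?invr_gt0// lerD2r.
  rewrite ge_max; apply/andP; split.
    by apply: le_trans (mono D1 C1 _ _ _); rewrite ?le_max ?lexx//; near: eps.
  by apply: le_trans (mono D2 C2 _ _ _); rewrite ?le_max ?lexx ?orbT//; near: eps.
have [D12|D12] := leP D1 D2.
  have [C C0 H] := L2 g g0; exists C => //; apply: filterS H => eps H.
  by rewrite le_max H orbT.
have [C C0 H] := L1 g g0; exists C => //; apply: filterS H => eps H.
by rewrite le_max H.
Unshelve. all: by end_near.
Qed.

(** Applied to logarithms of prefactors, this makes them vanish on the logarithmic scale. *)
Lemma scaled_cst_lt C g : 0 < g -> \forall eps \near (0 : R)^'+, eps * C < g.
Proof.
move=> g0; near=> eps; have eps0 : 0 < eps by near: eps; exact: nbhs_right_gt.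
have C1 : 0 < `|C| + 1 by rewrite ltr_pwDr.
apply: (@le_lt_trans _ _ (eps * (`|C| + 1))).
  by rewrite ler_pM2l// (le_trans (ler_norm C))// lerDl.
rewrite -ltr_pdivlMr//; near: eps; apply: nbhs_right_lt.
by rewrite divr_gt0.
Unshelve. all: by end_near.
Qed.

Lemma exp_rate_cvg G D : exp_rate G D -> eps * ln (G eps) @[eps --> 0^'+] --> D.
Proof.
move=> GD; have [U L] := GD; apply/cvgrPdist_lt => g g0.
have g2 : 0 < g / 2 by rewrite divr_gt0.
have [[C1 C10 H1] [C2 C20 H2]] := (U _ g2, L _ g2).
have G0 := exp_rate_gt0 _ _ GD.
have K1 := scaled_cst_lt (ln C1) _ g2; have K2 := scaled_cst_lt (- ln C2) _ g2.
have e0 : \forall eps \near (0 : R)^'+, 0 < eps by exact: nbhs_right_gt.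
near=> eps; have eps0 : 0 < eps by near: eps.
have lnE C x : 0 < C -> eps * ln (C * expR (x / eps)) = eps * ln C + x.
  move=> C0; rewrite lnM ?posrE ?expR_gt0// expRK mulrDr; congr (_ + _).
  by rewrite mulrC divfK// gt_eqF.
have Ge : 0 < G eps by near: eps.
have : eps * ln (G eps) <= eps * ln C1 + (D + g / 2).
  rewrite -lnE// ler_pM2l// ler_ln ?posrE ?mulr_gt0 ?expR_gt0//.
  by near: eps.
have : eps * ln C2 + (D - g / 2) <= eps * ln (G eps).
  rewrite -lnE// ler_pM2l// ler_ln ?posrE ?mulr_gt0 ?expR_gt0//.
  by near: eps.
have : eps * ln C1 < g / 2 by near: eps.
have : eps * - ln C2 < g / 2 by near: eps.
rewrite mulrN ltr_norml => *; apply/andP; lra.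
Unshelve. all: by end_near.
Qed.

(** Since [expR z >= z ^+ 2 / 2], the exponent on the left is at least of order [eps ^- 2], against
    [eps^-1] on the right. This makes late jumps negligible. *)
Lemma double_expR_le A D : 0 < A -> 0 < D -> forall B, 0 < B ->
  \forall eps \near (0 : R)^'+, expR (- (B * expR (A / eps))) <= expR (- D / eps).
Proof.
move=> A0 D0 B B0; near=> eps.
have eps0 : 0 < eps by near: eps; exact: nbhs_right_gt.
rewrite ler_expR mulNr lerN2.
have z0 : 0 < A / eps by rewrite divr_gt0.
apply: (@le_trans _ _ (B * ((A / eps) ^+ 2 / 2))); last first.
  rewrite ler_pM2l//; have := expR_ge1Dxn 1 (ltW z0); apply: le_trans.
  by rewrite factE/= lerDr ler01.
rewrite ler_pdivrMr//.
have -> : B * ((A / eps) ^+ 2 / 2) * eps = (B * A ^+ 2 / 2) / eps.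
  by field; rewrite gt_eqF.
rewrite ler_pdivlMr// mulrC -ler_pdivlMr//.
near: eps; apply: nbhs_right_le.
by rewrite divr_gt0// divr_gt0// mulr_gt0// exprn_gt0.
Unshelve. all: by end_near.
Qed.

(** From [1 + x <= expR x], the right side is at least [x / (1 + x)]. It turns an upper bound on
    survival into a lower bound on early jumps that is linear in the hazard. *)
Lemma one_sub_expRN_ge A x : 0 <= x <= A -> (1 + A)^-1 * x <= 1 - expR (- x).
Proof.
move=> /andP[x0 xA]; have x1 : 0 < 1 + x by lra.
apply: (@le_trans _ _ (1 - (1 + x)^-1)); last first.
  by rewrite lerD2l lerN2 expRN lef_pV2 ?posrE ?expR_gt0// expR_ge1Dx.
have -> : 1 - (1 + x)^-1 = (1 + x)^-1 * x by field; rewrite gt_eqF.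
by rewrite ler_wpM2r// lef_pV2 ?posrE; lra.
Qed.

End ExponentialRate.

(** * Short-time estimates from the forward equation *)

Section Transition.
Context {R : realType} (q : bool -> R -> R) (p : R -> R -> bool -> bool -> R).
Hypothesis p_trans : transition_function q p.
Hypothesis q_bounds : forall i t, 0 < t -> 0 <= q i t <= 1.
Implicit Types (s t m M : R) (i j k : bool).

Lemma transition_within s t u j k : 0 <= s -> s <= t ->
  {within `[t, u], continuous (fun r => p s r j k)}.
Proof.
move=> s0 st; apply: (@continuous_subspaceW _ _ _ `[s, +oo[%classic); last first.
  exact: (transition_continuous p_trans).
by move=> r; rewrite /= !in_itv/= andbT => /andP[tr _]; exact: le_trans tr.
Qed.

(** The forward equation conserves mass: the derivatives for [k] and [~~ k] cancel. *)
Lemma transition_sum1 s t j k : 0 <= s -> s <= t ->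
  p s t j k + p s t j (~~ k) = 1.
Proof.
move=> s0 st.
pose f u := p s u j k + p s u j (~~ k).
have cf : {within `[s, t], continuous f}.
  by move=> x; apply: continuousD; exact: transition_within.
have df u : s < u < t -> is_derive u 1 f 0.
  move=> /andP[su _].
  have := is_deriveD (transition_forward p_trans j k s0 su)
    (transition_forward p_trans j (~~ k) s0 su).
  by rewrite negbK addrA subrK subrr; exact.
have fs : f s = 1.
  by rewrite /f !(transition_start p_trans)//; case: j k {f cf df} => [] [];
    rewrite ?addr0 ?add0r.
rewrite -/(f t); apply/eqP; rewrite eq_le -fs -subr_le0 -[X in _ && X]subr_ge0.
have := ge_increment _ _ 0 _ _ st cf df (fun _ _ => lexx 0); rewrite mul0r => ->.
by have := le_increment _ _ 0 _ _ st cf df (fun _ _ => lexx 0); rewrite mul0r => ->.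
Qed.

(** Were one probability negative, the other would exceed 1 by mass conservation, and the forward
    equation would push the negative one upwards. *)
Lemma transition_ge0 s t j k : 0 <= s -> s <= t -> 0 <= p s t j k.
Proof.
move=> s0; apply: (nonneg_if_increasing_below (fun r => p s r j k)
  (fun u => p s u j (~~ k) * q (~~ k) u - p s u j k * q k u)).
- exact: (transition_continuous p_trans).
- by rewrite (transition_start p_trans).
- by move=> u su; exact: (transition_forward p_trans).
move=> u su pu; have u0 := le_lt_trans s0 su.
have := transition_sum1 s u j k s0 (ltW su).
have /andP[qk0 _] := q_bounds k u u0; have /andP[qnk0 _] := q_bounds (~~ k) u u0.
move=> pE; rewrite subr_ge0; apply: (@le_trans _ _ 0).
  by rewrite mulr_le0_ge0// ltW.
by rewrite mulr_ge0//; lra.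
Qed.

Lemma transition_le1 s t j k : 0 <= s -> s <= t -> p s t j k <= 1.
Proof.
move=> s0 st; rewrite -(transition_sum1 s t j k s0 st) lerDl.
exact: transition_ge0.
Qed.

(** The flow into [~~ i] is at most [M], and the flow back only reduces the growth. *)
Lemma transition_leave_le s t i M : 0 <= s -> s <= t ->
  (forall u, s < u < t -> q i u <= M) -> p s t i (~~ i) <= M * (t - s).
Proof.
move=> s0 st qM; have := ge_increment (fun u => p s u i (~~ i)) _ M _ _ st
  (transition_within s s t i (~~ i) s0 (lexx s))
  (fun u su => transition_forward p_trans i (~~ i) s0 (proj1 (andP su))).
rewrite (transition_start p_trans)// (_ : (i == ~~ i) = false); last by case: (i).
rewrite subr0; apply=> u hu.
have /andP[su ut] := hu; have u0 := le_lt_trans s0 su.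
rewrite negbK; have /andP[qi0 _] := q_bounds i u u0.
have /andP[qn0 _] := q_bounds (~~ i) u u0.
have := transition_ge0 s u i (~~ i) s0 (ltW su).
have := transition_le1 s u i i s0 (ltW su).
have := qM u hu; nra.
Qed.

(** As rates are at most 1, the mass at [~~ i] stays below [t - s]. So the inflow is at least
    [(1 - (t - s)) * m] and the flow back at most [t - s]. *)
Lemma transition_leave_ge s t i m : 0 <= s -> s <= t -> 0 <= m ->
  (forall u, s < u < t -> m <= q i u) ->
  ((1 - (t - s)) * m - (t - s)) * (t - s) <= p s t i (~~ i).
Proof.
move=> s0 st m0 qm.
have := le_increment (fun u => p s u i (~~ i)) _ ((1 - (t - s)) * m - (t - s)) _ _ st
  (transition_within s s t i (~~ i) s0 (lexx s))
  (fun u su => transition_forward p_trans i (~~ i) s0 (proj1 (andP su))).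
rewrite (transition_start p_trans)// (_ : (i == ~~ i) = false); last by case: (i).
rewrite subr0; apply=> u hu.
have /andP[su ut] := hu; have u0 := le_lt_trans s0 su.
rewrite negbK; have /andP[qi0 _] := q_bounds i u u0.
have /andP[qn0 qn1] := q_bounds (~~ i) u u0.
have v0 := transition_ge0 s u i (~~ i) s0 (ltW su).
have v1 : p s u i (~~ i) <= u - s.
  rewrite -[leRHS]mul1r; apply: transition_leave_le => //; first exact: ltW.
  by move=> r /andP[sr _]; have /andP[] := q_bounds i r (le_lt_trans s0 sr).
have uE := transition_sum1 s u i i s0 (ltW su).
have u0' := transition_ge0 s u i i s0 (ltW su).
have := qm u hu; nra.
Qed.

(** On a step of length at most [m / 4] the two losses in [transition_leave_ge] cost at most half of
    [m]; then [1 - z <= expR (- z)] gives a bound that multiplies over steps. *)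
Lemma transition_stay_le s t i m : 0 <= s -> s <= t -> 0 <= m <= 1 ->
  4 * (t - s) <= m -> (forall u, s < u < t -> m <= q i u) ->
  p s t i i <= expR (- (m / 2 * (t - s))).
Proof.
move=> s0 st /andP[m0 m1] tsm qm.
have := transition_sum1 s t i i s0 st.
have := transition_leave_ge s t i m s0 st m0 qm.
have := expR_ge1Dx (- (m / 2 * (t - s))).
have : m / 2 * (t - s) <= ((1 - (t - s)) * m - (t - s)) * (t - s).
  by rewrite ler_wpM2r ?subr_ge0//; nra.
lra.
Qed.

End Transition.

(** Union bound in product form, by induction from [1 - u a = (1 - u) + u (1 - a)]. *)
Lemma one_sub_prod_le {R : realDomainType} n (u : 'I_n -> R) :
  (forall k, 0 <= u k <= 1) -> 1 - \prod_k u k <= \sum_k (1 - u k).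
Proof.
elim: n u => [|n IHn] u hu; first by rewrite !big_ord0 subrr.
rewrite !big_ord_recl; set a := \prod_(_ < _) _; set b := \sum_(_ < _) _.
have ab : 1 - a <= b by apply: IHn.
have /andP[a0 a1] : 0 <= a <= 1.
  apply/andP; split; last by apply: prodr_ile1 => k _.
  by apply: prodr_ge0 => k _; case/andP: (hu (lift ord0 k)).
by have /andP[u0 u1] := hu ord0; nra.
Qed.

(** * Law of the first jump of the chain *)

Section HittingTime.
Context {R : realType} {dT : measure_display} {T : measurableType dT}.
Context (P : probability T R) (Y : R -> T -> bool) (q : bool -> R -> R) (i : bool).
Hypothesis Y_chain : markov_chain P Y q i.
Hypothesis q_bounds : forall j t, 0 < t -> 0 <= q j t <= 1.
Implicit Types (c m M s L : R).

Local Notation hit := (hitting_time Y (~~ i)).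

Lemma hitting_time_ltP c w :
  (hit w < c%:E)%E <-> exists2 t, 0 <= t < c & Y t w = ~~ i.
Proof.
split=> [/ereal_inf_lt[_ [t [t0 Yt] <-]]|[t /andP[t0 tc] Yt]].
  by rewrite lte_fin => tc; exists t; rewrite ?t0.
apply: (@le_lt_trans _ _ t%:E); last by rewrite lte_fin.
by apply: ereal_inf_lbound; exists t.
Qed.

(** If the chain has not jumped by time [c] inclusive, right continuity keeps it at [i] for a while
    longer, so the infimum exceeds [c]. *)
Lemma hitting_time_leP c w : 0 <= c ->
  (hit w <= c%:E)%E <-> (hit w < c%:E)%E \/ Y c w = ~~ i.
Proof.
move=> c0; split=> [hc|[/ltW//|Yc]]; last first.
  by apply: ereal_inf_lbound; exists c.
have [->|Yc] := eqVneq (Y c w) (~~ i); [by right|left].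
rewrite lt_neqAle hc andbT; apply/eqP => hE.
have Yci : Y c w = i by move: Yc; case: (Y c w) (i) => [] [].
have [d /= d0 Hd] := chain_right_continuous Y_chain w c0.
have : ((c + d)%:E <= hit w)%E.
  apply: le_ereal_inf_tmp => _ [t [t0 Yt] <-]; rewrite lee_fin leNgt; apply/negP => tcd.
  have [tc|ct] := ltP t c.
    have : (hit w < c%:E)%E by apply/hitting_time_ltP; exists t; rewrite ?t0.
    by rewrite hE ltxx.
  move: ct; rewrite le_eqVlt => /predU1P[ct|ct].
    by move: Yt; rewrite -ct Yci => /esym/eqP; rewrite -eqbF_neg; case: (i).
  have := Hd t; rewrite /= ltr0_norm ?subr_lt0// Yt Yci => /(_ ltac:(lra) ct).
  by move=> /eqP; case: (i).
by rewrite hE lee_fin leNgt ltrDl d0.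
Qed.

Lemma measurable_chain_state t j : 0 <= t -> measurable [set w | Y t w = j].
Proof.
move=> t0; have mY : measurable_fun setT (Y t) := chain_measurable Y_chain t0.
by rewrite -[X in measurable X]setTI; apply: (mY measurableT [set j]).
Qed.

Lemma measurable_stay n (t : nat -> R) : (forall k, 0 <= t k) ->
  measurable [set w | forall k, (k <= n)%N -> Y (t k) w = i].
Proof.
move=> t0; rewrite (_ : [set _ | _] =
    \bigcap_(k in [set k | (k <= n)%N]) [set w | Y (t k) w = i]) //.
by apply: bigcap_measurable => [|k _]; [exists 0%N | exact: measurable_chain_state].
Qed.

(** Each such event depends on finitely many times, and nested grids make them increase with [n].
    The point [c] is left out, matching the strict inequality in [hit w < c]. *)
Definition dyadic_hit c n : set T :=
  [set w | exists2 k : nat, (k < 2 ^ n)%N & Y (k%:R * (c / (2 ^ n)%:R)) w = ~~ i].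

Lemma dyadic_hitE c n :
  dyadic_hit c n =
  ~` [set w | forall k : nat, (k <= (2 ^ n).-1)%N -> Y (k%:R * (c / (2 ^ n)%:R)) w = i].
Proof.
have e2 : (2 ^ n)%N = (2 ^ n).-1.+1 by rewrite prednK// expn_gt0.
apply/seteqP; split=> w /=.
  move=> [k kn Yk] /(_ k); rewrite -ltnS -e2 Yk => /(_ kn).
  by case: (i).
move=> /existsNP[k /not_implyP[kn Yk]]; exists k; first by rewrite e2 ltnS.
by move: Yk; case: (Y _ w) (i) => [] [].
Qed.

Lemma dyadic_hit_nondecreasing c :
  {homo dyadic_hit c : m n / (m <= n)%N >-> (m <= n)%O}.
Proof.
move=> m n mn; apply/subsetPset => w [k km Yk].
exists (k * 2 ^ (n - m))%N.
  by rewrite -{2}(subnKC mn) expnD ltn_pmul2r// expn_gt0.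
rewrite -Yk; congr (Y _ w); rewrite -{2}(subnKC mn) expnD !natrM.
by field; rewrite !pnatr_eq0 -!lt0n !expn_gt0.
Qed.

Lemma bigcup_dyadic_hit c : 0 < c ->
  \bigcup_n dyadic_hit c n = [set w | (hit w < c%:E)%E].
Proof.
move=> c0; have e2 n : 0 < (2 ^ n)%:R :> R by rewrite ltr0n expn_gt0.
apply/seteqP; split=> w /=.
  move=> [n _ [k kn Yk]]; apply/hitting_time_ltP; eexists; last exact: Yk.
  apply/andP; split; first by rewrite mulr_ge0// divr_ge0// ltW.
  by rewrite mulrA ltr_pdivrMr// mulrC ltr_pM2l// ltr_nat.
move=> /hitting_time_ltP[t /andP[t0 tc] Yt].
have [d /= d0 Hd] := chain_right_continuous Y_chain w t0.
(* The state [~~ i] persists for a time [d] after [t]. A grid of mesh below [g] has a point in that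
   stretch and still before [c]. *)
pose g := Num.min d (c - t).
have g0 : 0 < g by rewrite lt_min d0 subr_gt0.
pose n := (Num.truncn (c / g)).+1.
have cn : c / (2 ^ n)%:R < g.
  rewrite ltr_pdivrMr// mulrC -ltr_pdivrMr//.
  apply: (@lt_trans _ _ n%:R); first exact: truncnS_gt.
  by rewrite ltr_nat ltn_expl.
set D := c / (2 ^ n)%:R in cn; have D0 : 0 < D by rewrite divr_gt0.
(* The first grid point strictly after [t], since right continuity speaks of later times only. *)
pose k := (Num.truncn (t / D)).+1.
have tk : t < k%:R * D by rewrite -ltr_pdivrMr//; exact: truncnS_gt.
have kt : k%:R * D <= t + D.
  rewrite /k -natr1 mulrDl mul1r lerD2r -ler_pdivlMr//.
  by rewrite truncn_le// divr_ge0// ltW.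
have gd : g <= d by rewrite ge_min lexx.
have gc : g <= c - t by rewrite ge_min lexx orbT.
exists n => //; exists k.
  rewrite -(ltr_nat R) -(ltr_pM2r D0) /D [X in _ < X]mulrC divfK ?gt_eqF// -/D.
  by lra.
by rewrite -Yt -/D; apply: Hd => //=; rewrite -/D ltr0_norm ?subr_lt0//; lra.
Qed.

Lemma measurable_dyadic_hit c n : 0 <= c -> measurable (dyadic_hit c n).
Proof.
move=> c0; rewrite dyadic_hitE; apply: measurableC.
by apply: (measurable_stay _ (fun k => k%:R * _)) => k; rewrite mulr_ge0// divr_ge0.
Qed.

Lemma measurable_hit_before c : 0 < c -> measurable [set w | (hit w < c%:E)%E].
Proof.
move=> c0; rewrite -bigcup_dyadic_hit//; apply: bigcup_measurable => n _.
by apply: measurable_dyadic_hit; exact: ltW.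
Qed.

Lemma measurable_hit_by c : 0 < c -> measurable [set w | (hit w <= c%:E)%E].
Proof.
move=> c0; rewrite (_ : [set _ | _] =
    [set w | (hit w < c%:E)%E] `|` [set w | Y c w = ~~ i]).
  apply: measurableU; first exact: measurable_hit_before.
  by apply: measurable_chain_state; exact: ltW.
by apply/seteqP; split=> w /=; have := hitting_time_leP c w (ltW c0); tauto.
Qed.

Lemma stay_probability : exists2 p, transition_function q p &
  forall n (t : nat -> R), t 0%N = 0 -> (forall k : nat, (k < n)%N -> t k < t k.+1) ->
    P [set w | forall k : nat, (k <= n)%N -> Y (t k) w = i]
    = (\prod_(k < n) p (t k) (t k.+1) i i)%:E.
Proof.
have [p p_trans Pp] := chain_distribution Y_chain; exists p => // n t t0 tS.
by rewrite (Pp n t (fun=> i))// eqxx mul1r.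
Qed.

(* Union bound over the steps of a dyadic grid, uniformly in its mesh. *)
Lemma hit_before_le c M : 0 < c -> (forall u, 0 < u < c -> q i u <= M) ->
  (P [set w | (hit w < c%:E)%E] <= (M * c)%:E)%E.
Proof.
move=> c0 qM; have [p p_trans stayP] := stay_probability.
have M0 : 0 <= M.
  apply: le_trans (qM (c / 2) _); last lra.
  by have /andP[] := q_bounds i (c / 2) ltac:(lra).
rewrite -bigcup_dyadic_hit//.
(* By continuity from below it suffices to treat each grid, where the finite-dimensional laws
   apply. *)
have cvgP := nondecreasing_cvg_mu (mu := P)
  (fun n => measurable_dyadic_hit c n (ltW c0))
  (bigcup_measurable (fun n _ => measurable_dyadic_hit c n (ltW c0)))
  (dyadic_hit_nondecreasing c).
rewrite -(cvg_lim (@ereal_hausdorff R) cvgP); apply: lime_le.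
  by apply/cvg_ex; eexists; exact: cvgP.
apply: nearW => n /=; rewrite dyadic_hitE.
set D := c / _; have D0 : 0 < D by rewrite divr_gt0// ltr0n expn_gt0.
(* The [2 ^ n] grid points are joined by one step fewer. *)
set N := (2 ^ n).-1.
have NE : N.+1 = (2 ^ n)%N by rewrite prednK// expn_gt0.
have DE : N.+1%:R * D = c by rewrite NE mulrC divfK// pnatr_eq0 -lt0n expn_gt0.
have t_ge0 k : 0 <= k%:R * D :> R by rewrite mulr_ge0// ltW.
have tS k : k%:R * D < k.+1%:R * D :> R by rewrite ltr_pM2r// ltr_nat.
rewrite probability_setC; last exact: (measurable_stay _ (fun k => k%:R * D)).
rewrite (stayP _ (fun k => k%:R * D))//; last by rewrite mul0r.
rewrite -EFinB lee_fin; apply: le_trans (one_sub_prod_le _ _ _) _.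
  move=> k; rewrite (transition_ge0 _ _ p_trans)//= ?(ltW (tS k))//.
  by rewrite (transition_le1 _ _ p_trans)//= (ltW (tS k)).
apply: (@le_trans _ _ (\sum_(k < N) M * D)).
  apply: ler_sum => k _; have kN : k.+1%:R * D <= c.
    by rewrite -DE ler_pM2r// ler_nat ltnS ltnW.
  have := transition_sum1 _ _ p_trans _ _ i i (t_ge0 k) (ltW (tS k)).
  have := transition_leave_le _ _ p_trans q_bounds _ _ i M (t_ge0 k) (ltW (tS k)).
  have -> : k.+1%:R * D - k%:R * D = D by rewrite -natr1; ring.
  have hq u : k%:R * D < u < k.+1%:R * D -> q i u <= M.
    move=> /andP[ku uk]; apply: qM; rewrite (le_lt_trans (t_ge0 k) ku)/=.
    exact: lt_le_trans kN.
  by move=> /(_ hq); lra.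
rewrite sumr_const card_ord -mulr_natr -mulrA ler_wpM2l// -DE mulrC.
by rewrite ler_pM2r// ler_nat.
Qed.

(** On this event the chain sits at [i] on a whole grid of [s, s + L]; the bounds of
    [transition_stay_le] multiply to the total hazard. *)
Lemma hit_from_le c s L m : 0 < s -> 0 < L -> s + L < c -> 0 < m <= 1 ->
  (forall u, s < u < s + L -> m <= q i u) ->
  (P [set w | (c%:E <= hit w)%E] <= (expR (- (m / 2 * L)))%:E)%E.
Proof.
move=> s0 L0 sLc /andP[m0 m1] qm; have [p p_trans stayP] := stay_probability.
have c0 : 0 < c by lra.
(* Enough steps for the mesh [D] to be at most [m / 4]. *)
pose N := Num.truncn (4 * L / m).
pose D := L / N.+1%:R.
have D0 : 0 < D by rewrite divr_gt0.
have Dm : 4 * D <= m.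
  rewrite mulrA ler_pdivrMr// [leRHS]mulrC -ler_pdivrMr//.
  exact/ltW/truncnS_gt.
have DE : N.+1%:R * D = L by rewrite mulrC divfK.
(* The finite-dimensional laws start at time 0, so 0 is put before the grid; the factor of the step
   from 0 to [s] is bounded by 1. *)
pose t k := if k is k'.+1 then s + k'%:R * D else 0.
have tS k : t k < t k.+1.
  by case: k => [|k] /=; rewrite ?mul0r ?addr0// ltrD2l ltr_pM2r// ltr_nat.
have t_ge0 k : 0 <= t k.
  case: k => [//|k]; apply: addr_ge0; first exact: ltW.
  by apply: mulr_ge0 => //; exact: ltW.
apply: (@le_trans _ _ (P [set w | forall k, (k <= N.+2)%N -> Y (t k) w = i])).
  apply: le_measure; rewrite ?inE.
  - rewrite (_ : [set _ | _] = ~` [set w | (hit w < c%:E)%E]).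
      exact/measurableC/measurable_hit_before.
    by apply/seteqP; split=> w /=; rewrite leNgt => /negP.
  - exact: measurable_stay.
  move=> w /= cw k kN; apply: contrapT => Yk.
  have : (hit w < c%:E)%E.
    apply/hitting_time_ltP; exists (t k).
      rewrite t_ge0/=; apply: le_lt_trans sLc.
      case: k kN {Yk} => [_|k]; first by rewrite /= ltW// addr_gt0.
      by rewrite ltnS => kN; rewrite /= lerD2l -DE ler_pM2r// ler_nat.
    by move: Yk; case: (Y _ w) (i) => [] [].
  by rewrite ltNge cw.
rewrite stayP// lee_fin big_ord_recl.
set X := \prod_(_ < _) _.
have p01 k : 0 <= p (t k) (t k.+1) i i <= 1.
  rewrite (transition_ge0 _ _ p_trans)//= ?(ltW (tS k))//.
  by rewrite (transition_le1 _ _ p_trans)//= (ltW (tS k)).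
have X0 : 0 <= X by apply: prodr_ge0 => k _; case/andP: (p01 (lift ord0 k)).
apply: (@le_trans _ _ X).
  by have /andP[_] := p01 0%N => ?; rewrite ler_piMl.
apply: (@le_trans _ _ (\prod_(k < N.+1) expR (- (m / 2 * D)))).
  apply: ler_prod => k _; rewrite (andP (p01 _)).1 /=.
  have E : t (lift ord0 k).+1 - t (lift ord0 k) = D.
    by rewrite /= -natr1; ring.
  rewrite -[in leRHS]E; apply: (transition_stay_le _ _ p_trans) => //.
  - exact: (t_ge0 (lift ord0 k)).
  - exact/ltW/(tS (lift ord0 k)).
  - by rewrite (ltW m0).
  - by rewrite E.
  move=> u /= /andP[su us]; apply: qm; apply/andP; split.
    by apply: le_lt_trans su; rewrite lerDl mulr_ge0// ltW.
  apply: (lt_le_trans us); rewrite lerD2l -DE ler_pM2r// ler_nat.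
  exact: ltn_ord.
have -> : m / 2 * L = m / 2 * D * N.+1%:R by rewrite -DE; ring.
by rewrite prodr_const card_ord -expRM_natr mulNr.
Qed.

(** A jump outside the window is early or late; for the lower estimate the early ones suffice. *)
Lemma window_setC c1 c2 : 0 < c1 -> 0 < c2 ->
  [/\ measurable [set w | (c1%:E <= hit w <= c2%:E)%E],
    (P (~` [set w | (c1%:E <= hit w <= c2%:E)%E]) <=
      P [set w | (hit w < c1%:E)%E] + P [set w | (c2%:E <= hit w)%E])%E &
    (1 - P [set w | (c1%:E <= hit w)%E] <=
      P (~` [set w | (c1%:E <= hit w <= c2%:E)%E]))%E].
Proof.
move=> c10 c20.
have fromE c : 0 < c -> [set w | (c%:E <= hit w)%E] = ~` [set w | (hit w < c%:E)%E].
  by move=> c0; apply/seteqP; split=> w /=; rewrite leNgt => /negP.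
have mfrom c : 0 < c -> measurable [set w | (c%:E <= hit w)%E].
  by move=> c0; rewrite fromE//; exact/measurableC/measurable_hit_before.
have mW : measurable [set w | (c1%:E <= hit w <= c2%:E)%E].
  rewrite (_ : [set _ | _] = [set w | (c1%:E <= hit w)%E] `&` [set w | (hit w <= c2%:E)%E]).
    by apply: measurableI; [exact: mfrom | exact: measurable_hit_by].
  by apply/seteqP; split=> w /=; [move=> /andP | move=> [-> ->]].
split=> //.
  apply: le_trans (measureU2 _ _ _); last 2 first.
  - exact: measurable_hit_before.
  - exact: mfrom.
  apply: le_measure; rewrite ?inE//; first exact: measurableC.
    by apply: measurableU; [exact: measurable_hit_before | exact: mfrom].
  move=> w /= /negP; rewrite negb_and -!ltNge => /orP[]; first by left.
  by move=> /ltW; right.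
rewrite -probability_setC; last exact: mfrom.
apply: le_measure; rewrite ?inE.
- exact/measurableC/mfrom.
- exact: measurableC.
by move=> w /= H /andP[].
Qed.

End HittingTime.

(** * Logarithmic rate of missing the window, for one starting state *)

Section WindowRate.
Context {R : realType} {dT : measure_display} {T : measurableType dT}.
Context (P : R -> probability T R) (Y : R -> R -> T -> bool).
Context (e : bool -> R -> R) (i : bool) (nu a h : R).
Hypothesis e_cont : {within `[0, +oo[, continuous (e i)}.
Hypothesis e_ge0 : forall j t, 0 <= t -> 0 <= e j t.
Hypothesis nu_gt0 : 0 < nu.
Hypothesis h_gt0 : 0 < h.
Hypothesis ah_gt0 : 0 < a - h.
Hypothesis Y_chain : forall eps, 0 < eps ->
  markov_chain (P eps) (Y eps) (jump_rate e eps nu) i.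

Let scale eps := time_scale eps nu.
Let window eps : set T := [set w |
  (((a - h) * scale eps)%:E <= hitting_time (Y eps) (~~ i) w
     <= ((a + h) * scale eps)%:E)%E].
Let E := e i (a - h).

Let scale_gt0 eps : 0 < scale eps. Proof. exact: expR_gt0. Qed.

Let a_plus_h_gt0 : 0 < a + h.
Proof. by have := h_gt0; have := ah_gt0; lra. Qed.

Let rate01 eps j t : 0 < eps -> 0 < t -> 0 <= jump_rate e eps nu j t <= 1.
Proof.
move=> eps0 t0; rewrite /jump_rate expR_ge0 expR_le1 mulNr oppr_le0.
by rewrite divr_ge0 ?e_ge0 ?divr_ge0 ?ltW ?scale_gt0.
Qed.

(** The hazard per unit of rescaled time at energy [x]. *)
Let rate_scale x eps : expR (- x / eps) * scale eps = expR ((nu - x) / eps).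
Proof. by rewrite /scale /time_scale -expRD mulrBl mulNr addrC. Qed.

(** Serves twice. With [v < nu] the hazard explodes and late jumps are negligible; with [v > nu] the
    hazard is small, and the complementary event gives the lower bound on early jumps. *)
Lemma hit_from_scaled_le (r l v : R) eps b :
  0 < eps -> 0 < r -> 0 < l -> r + l < b -> 0 <= v ->
  (forall u, r < u < r + l -> e i u <= v) ->
  (P eps [set w | ((b * scale eps)%:E <= hitting_time (Y eps) (~~ i) w)%E] <=
     (expR (- (l / 2 * expR ((nu - v) / eps))))%:E)%E.
Proof.
move=> eps0 r0 l0 rlb v0 ev; have T0 := scale_gt0 eps.
have -> : l / 2 * expR ((nu - v) / eps) = expR (- v / eps) / 2 * (l * scale eps).
  by rewrite -rate_scale; ring.
apply: (hit_from_le _ _ _ _ (Y_chain _ eps0) _ _ (r * scale eps)).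
- by move=> j t; exact: rate01.
- exact: mulr_gt0.
- exact: mulr_gt0.
- by rewrite -mulrDl ltr_pM2r.
- by rewrite expR_gt0 expR_le1 mulNr oppr_le0 divr_ge0// ltW.
move=> u /andP[ru ul]; rewrite /jump_rate ler_expR ler_pM2r ?invr_gt0// lerN2.
by apply: ev; rewrite ltr_pdivlMr// ltr_pdivrMr// ru mulrDl.
Qed.

Lemma measurable_window eps : 0 < eps -> measurable (window eps).
Proof.
move=> eps0; have [] // := window_setC _ _ _ _ (Y_chain _ eps0)
  ((a - h) * scale eps) ((a + h) * scale eps).
- by rewrite mulr_gt0.
- exact: mulr_gt0.
Qed.

Hypothesis nuE : nu < E.
Hypothesis E_min : forall t, 0 <= t <= a - h -> E <= e i t.
Hypothesis later_below : exists r, a < r < a + h /\ e i r < nu.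

Lemma window_complement_rate :
  exp_rate (fun eps => fine (P eps (~` window eps))) (nu - E).
Proof.
have [h0 ah0 nuE0] := And3 h_gt0 ah_gt0 nuE.
have bounds eps : 0 < eps ->
  [/\ measurable (window eps),
    (P eps (~` window eps) <=
      P eps [set w | (hitting_time (Y eps) (~~ i) w < ((a - h) * scale eps)%:E)%E] +
      P eps [set w | (((a + h) * scale eps)%:E <= hitting_time (Y eps) (~~ i) w)%E])%E &
    (1 - P eps [set w | (((a - h) * scale eps)%:E <= hitting_time (Y eps) (~~ i) w)%E]
      <= P eps (~` window eps))%E].
  move=> eps0; apply: (window_setC _ _ _ _ (Y_chain _ eps0)); exact: mulr_gt0.
have Pfin eps : 0 < eps -> P eps (~` window eps) \is a fin_num.
  move=> eps0; have [mW _ _] := bounds eps eps0.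
  by rewrite fin_num_measure//; exact: measurableC.
split=> g g0.
- have [r [/andP[ar rh] er]] := later_below.
  have r0 : 0 < r by lra.
  (* Strictly between [e i r] and [nu]: near [r] the energy stays below [v], with a gap to [nu] left
     over. *)
  pose v := (e i r + nu) / 2.
  have v0 : 0 <= v by have := e_ge0 i r (ltW r0); rewrite /v; lra.
  have [||d d0 Hd] := within_continuous_dist _ _ r (v - e i r) e_cont.
  + by rewrite /= in_itv/= andbT ltW.
  + by rewrite /v; lra.
  pose l := Num.min d (a + h - r) / 2.
  have l0 : 0 < l by rewrite divr_gt0// lt_min d0 subr_gt0.
  have ld : 2 * l <= d by rewrite mulrC divfK// ge_min lexx.
  have lh : 2 * l <= a + h - r by rewrite mulrC divfK// ge_min lexx orbT.
  (* The summand [a - h] pays for early jumps, the 1 for late ones. *)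
  exists (a - h + 1); first lra.
  have D0 : 0 < E - nu by rewrite subr_gt0.
  have nv : 0 < nu - v by rewrite /v; lra.
  have dbl := double_expR_le _ _ nv D0 (l / 2) ltac:(lra).
  near=> eps; have eps0 : 0 < eps by near: eps; exact: nbhs_right_gt.
  have [_ Ple _] := bounds eps eps0.
  have early : (P eps [set w |
      (hitting_time (Y eps) (~~ i) w < ((a - h) * scale eps)%:E)%E] <=
      ((a - h) * expR ((nu - E) / eps))%:E)%E.
    rewrite -rate_scale mulrCA.
    apply: (hit_before_le _ _ _ _ (Y_chain _ eps0)) => [j t||u /andP[u0 ua]].
    * exact: rate01.
    * by rewrite mulr_gt0.
    rewrite /jump_rate ler_expR ler_pM2r ?invr_gt0// lerN2; apply: E_min.
    apply/andP; split; last by rewrite ler_pdivrMr ?scale_gt0// ltW.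
    by apply: divr_ge0; [exact: ltW | exact/ltW/scale_gt0].
  have late := hit_from_scaled_le r l v eps (a + h) eps0 r0 l0 ltac:(lra) v0 _.
  have {late} late : (P eps [set w |
      (((a + h) * scale eps)%:E <= hitting_time (Y eps) (~~ i) w)%E] <=
      (expR ((nu - E) / eps))%:E)%E.
    apply: le_trans (late _) _.
      move=> u /andP[ru ul]; have := Hd u; rewrite /= in_itv/= andbT.
      rewrite (ltW (lt_trans r0 ru)) ltr0_norm ?subr_lt0//.
      move=> /(_ isT ltac:(lra)); rewrite ltr_norml /v; lra.
    rewrite lee_fin -(opprB E nu); near: eps; exact: dbl.
  rewrite -lee_fin fineK ?Pfin//; apply: le_trans Ple _.
  apply: (le_trans (leeD early late)); rewrite -EFinD lee_fin.
  rewrite -[X in _ + X]mul1r -mulrDl ler_wpM2l//; first lra.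
  by rewrite ler_expR ler_pM2r ?invr_gt0//; lra.
(* Lower bound: just before [a - h] the energy is below [E + g], and jumps during
   [a - h - l, a - h - l / 2] already suffice. *)
have [|d d0 Hd] := within_continuous_dist _ _ (a - h) g e_cont _ g0.
  by rewrite /= in_itv/= andbT ltW.
pose l := Num.min d (a - h) / 2.
have l0 : 0 < l by rewrite divr_gt0// lt_min d0.
have ld : 2 * l <= d by rewrite mulrC divfK// ge_min lexx.
have lh : 2 * l <= a - h by rewrite mulrC divfK// ge_min lexx orbT.
pose B := l / 2 / 2.
have B0 : 0 < B by rewrite /B; lra.
exists ((1 + B)^-1 * B); first by rewrite mulr_gt0// invr_gt0; lra.
near=> eps; have eps0 : 0 < eps by near: eps; exact: nbhs_right_gt.
have [_ _ Pge] := bounds eps eps0.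
rewrite -lee_fin fineK ?Pfin//; apply: le_trans Pge.
have late := hit_from_scaled_le (a - h - l) (l / 2) (E + g) eps (a - h) eps0
  ltac:(lra) ltac:(lra) ltac:(lra) ltac:(have := e_ge0 i (a - h) (ltW ah_gt0);
    rewrite -/E; lra) _.
have {late} late := late _.
apply: le_trans (leeB (lexx 1%E) (late _)); last first.
  move=> u /andP[ru ul]; have := Hd u; rewrite /= in_itv/= andbT.
  move=> /(_ ltac:(lra)); rewrite gtr0_norm ?subr_gt0; last lra.
  by move=> /(_ ltac:(lra)); rewrite ltr_norml -/E; lra.
rewrite -EFinB lee_fin opprD addrA -/B -mulrA.
(* As [nu < E + g], the hazard is at most [B], whence the constant [(1 + B)^-1]. *)
apply: one_sub_expRN_ge; rewrite mulr_ge0 ?expR_ge0 ?(ltW B0)//=.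
rewrite ler_piMr ?(ltW B0)// expR_le1 pmulr_lle0 ?invr_gt0//.
by lra.
Unshelve. all: by end_near.
Qed.

End WindowRate.

(** * Identification of the two functionals *)

Lemma energy_ge0 {R : realType} {d : nat} (b : R -> 'rV[R]_d -> 'rV[R]_d)
    (x : bool -> 'rV[R]_d) (chi : set 'rV[R]_d) i s : 0 <= energy b x chi i s.
Proof.
apply/fine_ge0/le_ereal_inf_tmp => _ [y _ <-].
apply: le_ereal_inf_tmp => _ [t _ <-]; apply: le_ereal_inf_tmp => _ [f _ <-].
rewrite /action; case: ifP => // _; rewrite mule_ge0 ?lee_fin ?invr_ge0//.
by apply: integral_ge0 => u _; rewrite lee_fin sqr_ge0.
Qed.

Lemma resonance_point_near {R : realType} (I : set R) (J J' : R -> R -> \bar R) mu :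
  (\forall h \near 0^'+, forall nu, I nu -> J h nu = J' h nu) ->
  resonance_point I J mu -> resonance_point I J' mu.
Proof.
move=> JJ' [Imu [m [m_min m_cvg]]]; split=> //; exists m; split=> //.
near=> h; have JE : forall nu, I nu -> J h nu = J' h nu by near: h.
have [Im Jm] : I (m h) /\ forall nu, I nu -> (J h (m h) <= J h nu)%E by near: h.
by split=> // nu Inu; rewrite -!JE//; exact: Jm.
Unshelve. all: by end_near.
Qed.

Lemma chain_window_limit {R : realType} (e : bool -> R -> R)
    {dT : measure_display} {T : measurableType dT}
    (P : R -> R -> bool -> probability T R) (Y : R -> R -> R -> T -> bool)
    (e_cont : forall i, {within `[0, +oo[, continuous (e i)})
    (e_ge0 : forall i t, 0 <= t -> 0 <= e i t)
    (e_min : forall i t, 0 < t -> local_min (e i) t -> forall s, 0 <= s -> e i t <= e i s)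
    (e_0 : forall i, inf_max e < e i 0)
    (Y_chain : forall (eps mu : R) (i : bool), 0 < eps -> 0 < mu ->
       markov_chain (P eps mu i) (Y eps mu) (jump_rate e eps mu) i) :
  let J h nu i := nu - e i (entrance_time e i nu - h) in
  \forall h \near 0^'+, forall nu, resonance_interval e nu ->
    (eps%:E * lne (1 - chain_window_prob e P Y h eps nu))%E
      @[eps --> 0^'+] --> (Num.max (J h nu false) (J h nu true))%:E.
Proof.
(* The level [D] is [inf_max e], the upper end of the resonance interval, so the threshold on [h] is
   the same for all [nu]. *)
move=> J; have H i := passage_minimum _ (e_cont i) (e_ge0 i) (e_min i) _ (e_0 i).
have [h0 h00 H0] := H false; have [h1 h10 H1] := H true.
near=> h => nu /andP[]; rewrite gt_max => /andP[nu0 nu1] nuI.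
have hgt0 : 0 < h by near: h; exact: nbhs_right_gt.
have hh0 : 0 < h < h0 by rewrite hgt0; near: h; exact: nbhs_right_lt.
have hh1 : 0 < h < h1 by rewrite hgt0; near: h; exact: nbhs_right_lt.
have nu_gt0 : 0 < nu.
  apply: le_lt_trans nu0; apply: lb_le_inf; first by exists (e false 0), 0 => /=.
  by move=> _ [t /= t0 <-]; exact: e_ge0.
pose W eps i := [set w |
  (((entrance_time e i nu - h) * time_scale eps nu)%:E
     <= hitting_time (Y eps nu) (~~ i) w
     <= ((entrance_time e i nu + h) * time_scale eps nu)%:E)%E].
pose G i eps := fine (P eps nu i (~` W eps i)).
have rate i : exp_rate (G i) (J h nu i) /\
    forall eps, 0 < eps -> measurable (W eps i).
  have [ah nuE E_min later] : let a := entrance_time e i nu in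
      [/\ 0 < a - h, nu < e i (a - h),
        forall t, 0 <= t <= a - h -> e i (a - h) <= e i t
      & exists r, a < r < a + h /\ e i r < nu].
    by case: i; [exact: H1 | exact: H0].
  have Yi eps : 0 < eps ->
      markov_chain (P eps nu i) (Y eps nu) (jump_rate e eps nu) i.
    by move=> eps0; exact: Y_chain.
  split.
    exact: (window_complement_rate (fun eps => P eps nu i) (fun eps => Y eps nu)
      e i nu (entrance_time e i nu) h).
  exact: (measurable_window (fun eps => P eps nu i) (fun eps => Y eps nu)
      e i nu (entrance_time e i nu) h).
have Grate := exp_rate_max _ _ _ _ (rate false).1 (rate true).1.
have G0 := exp_rate_gt0 _ _ Grate; have Gcvg := exp_rate_cvg _ _ Grate.
(* One minus the smaller window probability is the larger complement. It is positive for small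
   [eps], so [lne] reduces to [ln]. *)
suff logE : \forall eps \near 0^'+,
    (eps%:E * lne (1 - chain_window_prob e P Y h eps nu))%E =
    (eps * ln (Num.max (G false eps) (G true eps)))%:E.
  apply: cvg_EFin; first by apply: filterS logE => eps ->.
  by apply: cvg_trans Gcvg; apply: near_eq_cvg; apply: filterS logE => eps /= ->.
near=> eps.
have eps0 : 0 < eps by near: eps; exact: nbhs_right_gt.
have PE i : P eps nu i (W eps i) = (1 - G i eps)%:E.
  have mW := (rate i).2 eps eps0.
  have Pfin : P eps nu i (W eps i) \is a fin_num by rewrite fin_num_measure.
  by rewrite /G probability_setC// -(fineK Pfin) -EFinB /= subKr.
rewrite /chain_window_prob -!/(W _ _) !PE -EFin_min -EFinB.
have -> : 1 - Num.min (1 - G false eps) (1 - G true eps) =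
    Num.max (G false eps) (G true eps).
  by rewrite /Num.min /Num.max ltrD2l ltrN2; case: ltgtP => *; lra.
by rewrite lne_EFin ?EFinM//; near: eps.
Unshelve. all: by end_near.
Qed.

Theorem theorem3p6 (R : realType) (d : nat)
    (b : R -> 'rV[R]_d -> 'rV[R]_d)
    (x : bool -> 'rV[R]_d) (A : bool -> set 'rV[R]_d) (chi : set 'rV[R]_d)
    (hb : periodic_dissipative_drift b)
    (hbist : bistable b x A chi)
    (* the diffusions X^eps, indexed by eps, mu and the starting point *)
    (dX : measure_display) (OmegaX : measurableType dX)
    (PX : probability OmegaX R) (W : R -> OmegaX -> 'rV[R]_d)
    (hW : brownian_motion PX W)
    (X : R -> R -> 'rV[R]_d -> R -> OmegaX -> 'rV[R]_d)
    (hX : forall (eps mu : R) (x0 : 'rV[R]_d), 0 < eps -> 0 < mu ->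
            diffusion PX W b eps mu x0 (X eps mu x0))
    (* the energies *)
    (e : bool -> R -> R) (he : e = energy b x chi)
    (he_fin : forall (i : bool) (s : R), 0 <= s -> (exit_energy b x chi i s < +oo)%E)
    (he_cont : forall i, {within `[0, +oo[, continuous (e i)})
    (he_per : forall (i : bool) (t : R), 0 <= t -> e i (t + 1) = e i t)
    (he_mono : forall i, monotone_between_extremes (e i))
    (he_0 : forall i, inf_max e < e i 0)
    (* the chains Y^eps, with law PY eps mu i when started at i *)
    (dY : measure_display) (OmegaY : measurableType dY)
    (PY : R -> R -> bool -> probability OmegaY R)
    (Y : R -> R -> R -> OmegaY -> bool)
    (hY : forall (eps mu : R) (i : bool), 0 < eps -> 0 < mu ->
            markov_chain (PY eps mu i) (Y eps mu) (jump_rate e eps mu) i)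
    (phi : R) (hphi : 0 < phi < 1)
    (hphase : forall t : R, 0 <= t -> e false t = e true (t + phi)) :
  forall mu : R,
    diffusion_resonance_point b x chi mu <-> chain_resonance_point e PY Y mu.
Proof.
move=> mu; have e_ge0 i t : 0 <= t -> 0 <= e i t.
  by move=> _; rewrite he; exact: energy_ge0.
have lim := chain_window_limit e PY Y he_cont e_ge0
  (fun i => local_min_global (he_mono i)) he_0 hY.
rewrite /diffusion_resonance_point -he; split=> [mu_res|[J [J_lim]]].
  by eexists; split; [exact: lim | exact: mu_res].
(* For small [h], uniqueness of limits forces the given [J] to be the explicit functional on the
   resonance interval. *)
apply: resonance_point_near; apply: filterS2 J_lim lim => h Jh limh nu Inu.
exact: (cvg_unique (@ereal_hausdorff R) (Jh nu Inu) (limh nu Inu)).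
Qed.
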